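(* Let $n,d\ge 1$ be integers. Take as set of bridge elements $B=\{\bar e_i\mid 0<i<n\}\subset \mathbb{C}[S_{d,n}]$ and as set of bridge relations $R_B$ the relations listed in the context. Then the tied symmetric monoid $tS_n$ is a deframization of $S_{d,n}$, i.e. the algebra $D(\mathbb{C}[S_{d,n}])$ built from $B$ and $R_B$ by the deframization procedure is isomorphic to the monoid algebra $\mathbb{C}[tS_n]$.
   Context: Framed symmetric group: $S_{d,n}=(\mathbb{Z}/d\mathbb{Z})\wr S_n$, presented by generators $Y=\{s_1,\dots,s_{n-1},z_1,\dots,z_n\}$ and the set $S$ of relations: $s_i^2=1$; $s_is_j=s_js_i$ for $|i-j|>1$; $s_is_js_i=s_js_is_j$ for $|i-j|=1$; $z_i^d=1$; $z_iz_j=z_jz_i$; $z_js_i=s_iz_{s_i(j)}$, where $s_i(j)$ is the image of $j$ under the transposition $(i,i+1)$. Bridge elements: $\bar e_i=\frac1d\sum_{k=0}^{d-1}z_i^kz_{i+1}^{-k}\in\mathbb{C}[S_{d,n}]$, $1\le i\le n-1$. Bridge relations $R_B$: $\bar e_i^2=\bar e_i$; $\bar e_i\bar e_j=\bar e_j\bar e_i$; $s_i\bar e_j=\bar e_js_i$ if $|i-j|\ne1$; $\bar e_is_js_i=s_js_i\bar e_j$ if $|i-j|=1$; $\bar e_i\bar e_js_i=\bar e_js_i\bar e_j=s_i\bar e_i\bar e_j$ if $|i-j|=1$; $z_i\bar e_i=z_{i+1}\bar e_i=\bar e_iz_i=\bar e_iz_{i+1}$; $z_j\bar e_i=\bar e_iz_j$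 if $|i-j|>1$. Deframization procedure: introduce new symbols $B^*=\{\bar e_i^*\}$ in bijection with $B$. Let $\tilde A$ be the quotient of the free associative $\mathbb{C}$-algebra on $Y\cup B^*$ by the two-sided ideal generated by the relations $S$ together with the relations obtained from $R_B$ by replacing each $\bar e_i$ by $\bar e_i^*$. Then $D(\mathbb{C}[S_{d,n}])=\tilde A/I_z$, where $I_z$ is the two-sided ideal generated by $z_1-1,\dots,z_n-1$. Tied symmetric monoid: $tS_n$ is the monoid presented by generators $s_1,\dots,s_{n-1},e_1,\dots,e_{n-1}$ and relations: $s_i^2=1$; $s_is_j=s_js_i$ for $|i-j|>1$; $s_is_js_i=s_js_is_j$ for $|i-j|=1$; $e_i^2=e_i$; $e_ie_j=e_je_i$; $s_ie_j=e_js_i$ if $|i-j|\ne1$; $e_is_js_i=s_js_ie_j$ if $|i-j|=1$; $e_ie_js_i=e_js_ie_j=s_ie_ie_j$ if $|i-j|=1$. *)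

(* Defs.v *)
From HB Require Import structures.
From mathcomp Require Import all_boot all_order all_algebra.
From mathcomp Require Import perm zify.
From mathcomp Require Import boolp reals complex finmap monalg.

Set Implicit Arguments.
Unset Strict Implicit.
Unset Printing Implicit Defensive.

Import GRing.Theory Num.Theory.
Local Open Scope quotient_scope.
Local Open Scope ring_scope.

Definition free_monoid (X : choiceType) : Type := seq X.

HB.instance Definition _ (X : choiceType) := Choice.on (free_monoid X).
HB.instance Definition _ (X : choiceType) :=
  isMonoid.Build (free_monoid X) (@catA X) (@cat0s X) (@cats0 X).

(* [R u v] stands for the relation u = v between words over X. *)
Definition word_rel (X : choiceType) := free_monoid X -> free_monoid X -> Prop.

Inductive monoid_cong (X : choiceType) (R : word_rel X) : word_rel X :=
| MCongRel u v x y of R x y : monoid_cong R (u * x * v)%g (u * y * v)%g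
| MCongRefl x : monoid_cong R x x
| MCongSym x y of monoid_cong R x y : monoid_cong R y x
| MCongTrans x y z of monoid_cong R x y & monoid_cong R y z :
    monoid_cong R x z.

Section PresentedMonoid.
Variables (X : choiceType) (R : word_rel X).

Definition monoid_congb (x y : free_monoid X) : bool :=
  `[< monoid_cong R x y >].

Lemma monoid_congb_equiv : equiv_class_of monoid_congb.
Proof.
split=> [x|x y|y x z].
- exact/asboolP/MCongRefl.
- by apply/asboolP/asboolP; apply: MCongSym.
- by move=> /asboolP xy /asboolP yz; apply/asboolP; apply: MCongTrans yz.
Qed.

Canonical monoid_congb_equivRel := EquivRelPack monoid_congb_equiv.
Canonical monoid_congb_encModRel := defaultEncModRel monoid_congb.

Lemma monoid_congM x y x' y' : monoid_cong R x x' -> monoid_cong R y y' ->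
  monoid_cong R (x * y)%g (x' * y')%g.
Proof.
move=> xx' yy'; apply: (@MCongTrans _ _ _ (x' * y)%g).
  elim: xx' => {x x'} [u v a b Rab|a|a b _ IH|a b c _ IH1 _ IH2].
  - by rewrite -[(u * a * v * y)%g]mulgA -[(u * b * v * y)%g]mulgA;
       apply: MCongRel.
  - exact: MCongRefl.
  - exact: MCongSym.
  - exact: MCongTrans IH1 IH2.
elim: yy' => {y y'} [u v a b Rab|a|a b _ IH|a b c _ IH1 _ IH2].
- by rewrite !mulgA; apply: MCongRel.
- exact: MCongRefl.
- exact: MCongSym.
- exact: MCongTrans IH1 IH2.
Qed.

Definition presented_monoid : Type := {eq_quot monoid_congb}.

HB.instance Definition _ : EqQuotient (free_monoid X) monoid_congb
  presented_monoid := EqQuotient.on presented_monoid.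
HB.instance Definition _ := Choice.on presented_monoid.

Definition pm_class (w : free_monoid X) : presented_monoid :=
  \pi_presented_monoid w.

Lemma pm_classP x y : (pm_class x = pm_class y) <-> monoid_cong R x y.
Proof.
split=> [/eqP|xy]; first by rewrite /pm_class piE => /asboolP.
by apply/eqP; rewrite /pm_class piE; apply/asboolP.
Qed.

Definition pm_mul (x y : presented_monoid) := pm_class (repr x * repr y)%g.

Lemma pm_class_mul x y : pm_mul (pm_class x) (pm_class y) = pm_class (x * y)%g.
Proof.
by apply/pm_classP/monoid_congM; apply/pm_classP; rewrite /pm_class reprK.
Qed.

Lemma pm_reprK x : pm_class (repr x) = x. Proof. exact: reprK. Qed.

Lemma pm_mulA : associative pm_mul.
Proof.
by move=> x y z; rewrite -[x]pm_reprK -[y]pm_reprK -[z]pm_reprK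
  !pm_class_mul mulgA.
Qed.

Lemma pm_mul1 : left_id (pm_class 1%g) pm_mul.
Proof. by move=> x; rewrite -[x]pm_reprK !pm_class_mul mul1g. Qed.

Lemma pm_mulr1 : right_id (pm_class 1%g) pm_mul.
Proof. by move=> x; rewrite -[x]pm_reprK !pm_class_mul mulg1. Qed.

HB.instance Definition _ :=
  isMonoid.Build presented_monoid pm_mulA pm_mul1 pm_mulr1.

Lemma pm_classM x y : pm_class (x * y)%g = (pm_class x * pm_class y)%g.
Proof. by rewrite -pm_class_mul. Qed.

Lemma pm_class_rel x y : R x y -> pm_class x = pm_class y.
Proof.
move=> Rxy; apply/pm_classP.
by rewrite -[x]mul1g -[y]mul1g -[(1 * x)%g]mulg1 -[(1 * y)%g]mulg1;
  apply: MCongRel.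
Qed.

End PresentedMonoid.

(* The ring structure that monalg.v puts on {malg K[M]} only covers monoids
   without non-trivial units, so the convolution product is redefined here for
   an arbitrary monoid M. *)

Definition monoid_alg (K : comNzRingType) (M : monoidType) : Type :=
  {malg K[M]}.

Section MonoidAlgebra.
Variables (K : comNzRingType) (M : monoidType).
Local Notation A := (monoid_alg K M).

HB.instance Definition _ := GRing.Lmodule.copy A {malg K[M]}.

Definition mon (m : M) : A := << m >>.

Definition malg_conv (f g : A) : A :=
  \sum_(x <- msupp f) \sum_(y <- msupp g) << f@_x * g@_y *g (x * y)%g >>.

Lemma malg_convw (d1 d2 : {fset M}) (f g : A) :
  fsubset (msupp f) d1 -> fsubset (msupp g) d2 -> malg_conv f g =
  \sum_(x <- d1) \sum_(y <- d2) << f@_x * g@_y *g (x * y)%g >>.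
Proof.
move=> le1 le2; rewrite /malg_conv (big_fset_incl _ le1) /=.
  apply/eq_bigr=> x _; apply/big_fset_incl => // k _ /mcoeff_outdom ->.
  by rewrite mulr0 monalgU0.
move=> k _ /mcoeff_outdom fk; rewrite big1 // => y _.
by rewrite fk mul0r monalgU0.
Qed.

Lemma malg_convDl : left_distributive malg_conv +%R.
Proof.
move=> f g h; pose d := fsetU (msupp f) (msupp g).
rewrite (@malg_convw d (msupp h)) ?msuppD_le ?fsubset_refl //.
rewrite (@malg_convw d (msupp h) f) ?fsubsetUl ?fsubset_refl //.
rewrite (@malg_convw d (msupp h) g) ?fsubsetUr ?fsubset_refl //.
rewrite -big_split /=; apply/eq_bigr=> x _.
rewrite -big_split /=; apply/eq_bigr=> y _.
by rewrite mcoeffD mulrDl monalgUD.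
Qed.

Lemma malg_convDr : right_distributive malg_conv +%R.
Proof.
move=> f g h; pose d := fsetU (msupp g) (msupp h).
rewrite (@malg_convw (msupp f) d) ?msuppD_le ?fsubset_refl //.
rewrite (@malg_convw (msupp f) d f g) ?fsubsetUl ?fsubset_refl //.
rewrite (@malg_convw (msupp f) d f h) ?fsubsetUr ?fsubset_refl //.
rewrite -big_split /=; apply/eq_bigr=> x _.
rewrite -big_split /=; apply/eq_bigr=> y _.
by rewrite mcoeffD mulrDr monalgUD.
Qed.

Lemma malg_conv0l g : malg_conv 0 g = 0.
Proof. by rewrite /malg_conv msupp0 big_seq_fset0. Qed.

Lemma malg_conv0r f : malg_conv f 0 = 0.
Proof. by rewrite /malg_conv msupp0 big1 // => x _; rewrite big_seq_fset0. Qed.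

Lemma malg_convUU a b x y :
  malg_conv << a *g x >> << b *g y >> = << a * b *g (x * y)%g >>.
Proof.
by rewrite (malg_convw msuppU_le msuppU_le) !big_seq_fset1 !mcoeffUU.
Qed.

Lemma malg_convZl a f g : a *: malg_conv f g = malg_conv (a *: f) g.
Proof.
rewrite (malg_convw (msuppZ_le _ _) (fsubset_refl _)) scaler_sumr.
apply: eq_bigr => x _; rewrite scaler_sumr; apply: eq_bigr => y _.
apply/malgP => k; rewrite !mcoeffsE.
by case: (_ == _); rewrite ?mulr1n ?mulr0n ?mulr0 ?mulrA.
Qed.

Lemma malg_convZr a f g : a *: malg_conv f g = malg_conv f (a *: g).
Proof.
rewrite (malg_convw (fsubset_refl _) (msuppZ_le _ _)) scaler_sumr.
apply: eq_bigr => x _; rewrite scaler_sumr; apply: eq_bigr => y _.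
apply/malgP => k; rewrite !mcoeffsE.
by case: (_ == _); rewrite ?mulr1n ?mulr0n ?mulr0 // mulrCA.
Qed.

Lemma bilinear_opA (op : A -> A -> A) :
  left_distributive op +%R -> right_distributive op +%R ->
  left_zero 0 op -> right_zero 0 op ->
  (forall a b c x y z, op << a *g x >> (op << b *g y >> << c *g z >>) =
                       op (op << a *g x >> << b *g y >>) << c *g z >>) ->
  associative op.
Proof.
move=> opDl opDr op0l op0r opUA f g h.
have suml I (r : seq I) (F : I -> A) c :
  op (\sum_(i <- r) F i) c = \sum_(i <- r) op (F i) c.
  exact: (big_morph (op^~ c) (fun a b => opDl a b c) (op0l c)).
have sumr I (r : seq I) (F : I -> A) c :
  op c (\sum_(i <- r) F i) = \sum_(i <- r) op c (F i).
  exact: (big_morph (op c) (fun a b => opDr c a b) (op0r c)).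
rewrite [f]monalgE !(suml, sumr); apply: eq_bigr => x _.
rewrite [g]monalgE !(suml, sumr); apply: eq_bigr => y _.
rewrite [h]monalgE !(suml, sumr); apply: eq_bigr => z _.
exact: opUA.
Qed.

Lemma malg_convA : associative malg_conv.
Proof.
apply: (bilinear_opA malg_convDl malg_convDr malg_conv0l malg_conv0r).
by move=> a b c x y z; rewrite !malg_convUU mulrA mulgA.
Qed.

Lemma malg_conv1l : left_id (mon 1%g) malg_conv.
Proof.
move=> f; rewrite /malg_conv msuppU oner_eq0 big_seq_fset1 [RHS]monalgE.
by apply: eq_bigr => x _; rewrite mcoeffUU mul1r mul1g.
Qed.

Lemma malg_conv1r : right_id (mon 1%g) malg_conv.
Proof.
move=> f; rewrite /malg_conv exchange_big msuppU oner_eq0 big_seq_fset1.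
by rewrite [RHS]monalgE; apply: eq_bigr => x _; rewrite mcoeffUU mulr1 mulg1.
Qed.

Lemma malg_one_neq0 : mon 1%g != 0.
Proof. by rewrite monalgU_eq0 oner_eq0. Qed.

HB.instance Definition _ := GRing.Zmodule_isNzRing.Build A
  malg_convA malg_conv1l malg_conv1r malg_convDl malg_convDr malg_one_neq0.
HB.instance Definition _ := GRing.Lmodule_isLalgebra.Build K A malg_convZl.
HB.instance Definition _ := GRing.Lalgebra_isAlgebra.Build K A malg_convZr.

Lemma mon1 : mon 1%g = 1. Proof. by []. Qed.

Lemma monM x y : mon (x * y)%g = mon x * mon y.
Proof. by rewrite [RHS]malg_convUU mulr1. Qed.

Lemma monoid_algE (f : A) : f = \sum_(x <- msupp f) f@_x *: mon x.
Proof.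
rewrite [LHS]monalgE; apply: eq_bigr => x _; apply/malgP => k.
by rewrite !mcoeffsE mulr_natr.
Qed.

(* The augmentation K[M] -> K, sending every element of M to 1. *)
Definition augment (f : A) : K := \sum_(x <- msupp f) f@_x.

Lemma augmentw (d : {fset M}) f : fsubset (msupp f) d ->
  augment f = \sum_(x <- d) f@_x.
Proof.
by move=> le; apply: big_fset_incl => // k _ /mcoeff_outdom ->.
Qed.

Lemma augmentU a x : augment << a *g x >> = a.
Proof. by rewrite (augmentw msuppU_le) big_seq_fset1 mcoeffUU. Qed.

Lemma augment_is_linear : linear_for *%R augment.
Proof.
move=> a f g; pose d := fsetU (msupp f) (msupp g).
have le : fsubset (msupp (a *: f + g)) d.
  apply: fsubset_trans (msuppD_le _ _) _.
  by apply: fsetUSS (fsubset_refl _); apply: msuppZ_le.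
rewrite (augmentw le) (@augmentw d f) ?fsubsetUl //.
rewrite (@augmentw d g) ?fsubsetUr //.
rewrite mulr_sumr -big_split /=; apply: eq_bigr => x _.
by rewrite mcoeffD mcoeffZ.
Qed.

HB.instance Definition _ :=
  GRing.isLinear.Build K A K *%R augment augment_is_linear.

Lemma augment_is_monoid_morphism : GRing.monoid_morphism augment.
Proof.
split=> [|f g]; first exact: augmentU.
have -> : f * g = malg_conv f g by [].
rewrite /malg_conv raddf_sum [augment f]/augment mulr_suml.
apply: eq_bigr => x _; rewrite raddf_sum mulr_sumr; apply: eq_bigr => y _.
exact: augmentU.
Qed.

HB.instance Definition _ :=
  GRing.isMonoidMorphism.Build A K augment augment_is_monoid_morphism.

Lemma augment_mon x : augment (mon x) = 1. Proof. exact: augmentU. Qed.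

End MonoidAlgebra.

Inductive ideal_span (A : nzRingType) (G : A -> Prop) : A -> Prop :=
| IdealSpan0 : ideal_span G 0
| IdealSpanD x y of ideal_span G x & ideal_span G y : ideal_span G (x + y)
| IdealSpanG a g b of G g : ideal_span G (a * g * b).

(* Since algType requires 1 != 0, we only quotient by proper ideals. *)
Record two_sided_ideal (A : nzRingType) := TwoSidedIdeal {
  ideal_pred :> {pred A};
  ideal_zmod_closed : zmod_closed ideal_pred;
  ideal_mull : forall a x, x \in ideal_pred -> a * x \in ideal_pred;
  ideal_mulr : forall a x, x \in ideal_pred -> x * a \in ideal_pred;
  ideal_proper : 1 \notin ideal_pred
}.

HB.instance Definition _ (A : nzRingType) (I : two_sided_ideal A) :=
  GRing.isZmodClosed.Build A (ideal_pred I) (ideal_zmod_closed I).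

Section GeneratedIdeal.
Variables (A : nzRingType) (G : A -> Prop) (proper : ~ ideal_span G 1).

Lemma ideal_span_mull a x : ideal_span G x -> ideal_span G (a * x).
Proof.
elim=> {x} [|x y _ IHx _ IHy|b g c Gg].
- by rewrite mulr0; apply: IdealSpan0.
- by rewrite mulrDr; apply: IdealSpanD.
- by rewrite !mulrA; apply: IdealSpanG.
Qed.

Lemma ideal_span_mulr a x : ideal_span G x -> ideal_span G (x * a).
Proof.
elim=> {x} [|x y _ IHx _ IHy|b g c Gg].
- by rewrite mul0r; apply: IdealSpan0.
- by rewrite mulrDl; apply: IdealSpanD.
- by rewrite -mulrA; apply: IdealSpanG.
Qed.

Definition ideal_spanb : {pred A} := fun x => `[< ideal_span G x >].

Lemma ideal_spanbP x : reflect (ideal_span G x) (x \in ideal_spanb).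
Proof. exact: asboolP. Qed.

Lemma ideal_spanb_zmod_closed : zmod_closed ideal_spanb.
Proof.
split=> [|x y /ideal_spanbP Gx /ideal_spanbP Gy]; apply/ideal_spanbP.
  exact: IdealSpan0.
by apply: IdealSpanD => //; rewrite -mulN1r; apply: ideal_span_mull.
Qed.

Lemma ideal_spanb_mull a x : x \in ideal_spanb -> a * x \in ideal_spanb.
Proof. by move=> /ideal_spanbP Gx; apply/ideal_spanbP/ideal_span_mull. Qed.

Lemma ideal_spanb_mulr a x : x \in ideal_spanb -> x * a \in ideal_spanb.
Proof. by move=> /ideal_spanbP Gx; apply/ideal_spanbP/ideal_span_mulr. Qed.

Lemma ideal_spanb_proper : 1 \notin ideal_spanb.
Proof. by apply/ideal_spanbP. Qed.

Definition generated_ideal : two_sided_ideal A :=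
  TwoSidedIdeal ideal_spanb_zmod_closed ideal_spanb_mull ideal_spanb_mulr
    ideal_spanb_proper.

End GeneratedIdeal.

Definition quotient_alg (K : comNzRingType) (A : algType K)
  (I : two_sided_ideal A) : Type := {ideal_quot I}.

Section QuotientAlgebra.
Variables (K : comNzRingType) (A : algType K) (I : two_sided_ideal A).
Local Notation Q := (quotient_alg I).

HB.instance Definition _ := GRing.Zmodule.copy Q {ideal_quot I}.

Definition quot_proj (x : A) : Q := \pi_{ideal_quot I} x.

Lemma quot_projP x y : quot_proj x = quot_proj y <-> x - y \in I.
Proof.
have E := Quotient.idealrBE I x y.
by split=> [/eqP|xy]; [rewrite E | apply/eqP; rewrite -E].
Qed.

Definition quot_lift (x : Q) : A := repr x.

Lemma quot_liftK : cancel quot_lift quot_proj.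
Proof. by move=> x; apply: reprK. Qed.

Lemma quot_lift_proj x : quot_lift (quot_proj x) - x \in I.
Proof. by apply/quot_projP; rewrite quot_liftK. Qed.

Lemma quot_proj_is_zmod_morphism : zmod_morphism quot_proj.
Proof. by move=> x y; rewrite /quot_proj !piE. Qed.

HB.instance Definition _ :=
  GRing.isZmodMorphism.Build A Q quot_proj quot_proj_is_zmod_morphism.

Definition quot_mul (x y : Q) : Q := quot_proj (quot_lift x * quot_lift y).
Definition quot_scale (k : K) (x : Q) : Q := quot_proj (k *: quot_lift x).

Lemma quot_projM x y : quot_mul (quot_proj x) (quot_proj y) = quot_proj (x * y).
Proof.
apply/quot_projP; set x' := quot_lift _; set y' := quot_lift _.
have -> : x' * y' - x * y = x' * (y' - y) + (x' - x) * y.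
  by rewrite mulrBr mulrBl addrA subrK.
by apply: rpredD; [apply: ideal_mull|apply: ideal_mulr]; apply: quot_lift_proj.
Qed.

Lemma quot_projZ k x : quot_scale k (quot_proj x) = quot_proj (k *: x).
Proof.
apply/quot_projP; rewrite -scalerBr -[_ - _]mul1r scalerAl.
by rewrite ideal_mull ?quot_lift_proj.
Qed.

Lemma quot_mulA : associative quot_mul.
Proof.
by move=> x y z; rewrite -[x]quot_liftK -[y]quot_liftK -[z]quot_liftK
  !quot_projM mulrA.
Qed.

Lemma quot_mul1 : left_id (quot_proj 1) quot_mul.
Proof. by move=> x; rewrite -[x]quot_liftK quot_projM mul1r. Qed.

Lemma quot_mulr1 : right_id (quot_proj 1) quot_mul.
Proof. by move=> x; rewrite -[x]quot_liftK quot_projM mulr1. Qed.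

Lemma quot_mulDl : left_distributive quot_mul +%R.
Proof.
move=> x y z; rewrite -[x]quot_liftK -[y]quot_liftK -[z]quot_liftK.
by rewrite -raddfD !quot_projM mulrDl raddfD.
Qed.

Lemma quot_mulDr : right_distributive quot_mul +%R.
Proof.
move=> x y z; rewrite -[x]quot_liftK -[y]quot_liftK -[z]quot_liftK.
by rewrite -raddfD !quot_projM mulrDr raddfD.
Qed.

Lemma quot_one_neq0 : quot_proj 1 != 0.
Proof.
apply/eqP; rewrite -(raddf0 quot_proj) => /quot_projP.
by rewrite subr0; apply/negP/ideal_proper.
Qed.

HB.instance Definition _ := GRing.Zmodule_isNzRing.Build Q
  quot_mulA quot_mul1 quot_mulr1 quot_mulDl quot_mulDr quot_one_neq0.

Lemma quot_scaleA a b x : quot_scale a (quot_scale b x) = quot_scale (a * b) x.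
Proof. by rewrite -[x]quot_liftK !quot_projZ scalerA. Qed.

Lemma quot_scale1 : left_id 1 quot_scale.
Proof. by move=> x; rewrite -[x]quot_liftK quot_projZ scale1r. Qed.

Lemma quot_scaleDr : right_distributive quot_scale +%R.
Proof.
move=> a x y; rewrite -[x]quot_liftK -[y]quot_liftK.
by rewrite -raddfD !quot_projZ scalerDr raddfD.
Qed.

Lemma quot_scaleDl x : {morph quot_scale^~ x : a b / a + b}.
Proof. by move=> a b; rewrite -[x]quot_liftK !quot_projZ scalerDl raddfD. Qed.

HB.instance Definition _ := GRing.Zmodule_isLmodule.Build K Q
  quot_scaleA quot_scale1 quot_scaleDr quot_scaleDl.

Lemma quot_scaleAl a (x y : Q) : a *: (x * y) = (a *: x) * y.
Proof.
rewrite -[x]quot_liftK -[y]quot_liftK.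
by rewrite [RHS](congr1 (quot_mul^~ _) (quot_projZ _ _)) [LHS](congr1
  (quot_scale a) (quot_projM _ _)) quot_projZ quot_projM scalerAl.
Qed.

Lemma quot_scaleAr a (x y : Q) : a *: (x * y) = x * (a *: y).
Proof.
rewrite -[x]quot_liftK -[y]quot_liftK.
by rewrite [RHS](congr1 (quot_mul _) (quot_projZ _ _)) [LHS](congr1
  (quot_scale a) (quot_projM _ _)) quot_projZ quot_projM scalerAr.
Qed.

HB.instance Definition _ := GRing.Lmodule_isLalgebra.Build K Q quot_scaleAl.
HB.instance Definition _ := GRing.Lalgebra_isAlgebra.Build K Q quot_scaleAr.

Lemma quot_proj_is_monoid_morphism : GRing.monoid_morphism quot_proj.
Proof. by split=> // x y; rewrite -quot_projM. Qed.

HB.instance Definition _ :=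
  GRing.isMonoidMorphism.Build A Q quot_proj quot_proj_is_monoid_morphism.

Lemma quot_proj_is_scalable : scalable quot_proj.
Proof. by move=> a x; rewrite -quot_projZ. Qed.

HB.instance Definition _ :=
  GRing.isScalable.Build K A Q *:%R quot_proj quot_proj_is_scalable.

End QuotientAlgebra.

Lemma ideal_span_morph (A B : nzRingType) (f : {rmorphism A -> B})
    (G : A -> Prop) : (forall g, G g -> f g = 0) ->
  forall x, ideal_span G x -> f x = 0.
Proof.
move=> fG x; elim=> {x} [|x y _ fx _ fy|a g b Gg]; first exact: rmorph0.
  by rewrite rmorphD fx fy addr0.
by rewrite !rmorphM (fG g) // mulr0 mul0r.
Qed.

Lemma ideal_span_proper (A B : nzRingType) (f : {rmorphism A -> B})
    (G : A -> Prop) : (forall g, G g -> f g = 0) -> ~ ideal_span G 1.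
Proof.
by move=> fG /(ideal_span_morph fG)/eqP; rewrite rmorph1 oner_eq0.
Qed.

Definition free_alg (K : comNzRingType) (X : choiceType) : algType K :=
  monoid_alg K (free_monoid X).

Section PresentedAlgebra.
Variables (K : comNzRingType) (X : choiceType) (R : word_rel X).

Definition word_rel_diff (x : free_alg K X) : Prop :=
  exists u v, R u v /\ x = mon K u - mon K v.

Lemma augment_word_rel_diff (x : free_alg K X) :
  word_rel_diff x -> augment x = 0.
Proof. by case=> u [v [_ ->]]; rewrite raddfB /= !augment_mon subrr. Qed.

Lemma word_rel_proper : ~ ideal_span word_rel_diff 1.
Proof. exact: (ideal_span_proper augment_word_rel_diff). Qed.

Definition presented_alg : algType K :=
  quotient_alg (generated_ideal word_rel_proper).

Definition pa_word (w : free_monoid X) : presented_alg :=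
  quot_proj (generated_ideal word_rel_proper) (mon K w).

Definition pa_augment (x : presented_alg) : K := augment (quot_lift x).

Lemma pa_augment_proj (x : free_alg K X) :
  pa_augment (quot_proj (generated_ideal word_rel_proper) x) = augment x.
Proof.
apply/eqP; rewrite -subr_eq0 -raddfB; apply/eqP.
apply: (ideal_span_morph augment_word_rel_diff).
exact/ideal_spanbP/quot_lift_proj.
Qed.

Lemma pa_augment_is_zmod_morphism : zmod_morphism pa_augment.
Proof.
move=> x y; rewrite -[x]quot_liftK -[y]quot_liftK -raddfB !pa_augment_proj.
exact: raddfB.
Qed.

HB.instance Definition _ := GRing.isZmodMorphism.Build presented_alg K
  pa_augment pa_augment_is_zmod_morphism.

Lemma pa_augment_is_monoid_morphism : GRing.monoid_morphism pa_augment.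
Proof.
split=> [|x y]; first by rewrite [LHS]pa_augment_proj rmorph1.
rewrite -[x]quot_liftK -[y]quot_liftK -rmorphM !pa_augment_proj.
exact: rmorphM.
Qed.

HB.instance Definition _ := GRing.isMonoidMorphism.Build presented_alg K
  pa_augment pa_augment_is_monoid_morphism.

Lemma pa_augment_word w : pa_augment (pa_word w) = 1.
Proof. by rewrite pa_augment_proj augment_mon. Qed.

End PresentedAlgebra.

(* G is the group presented by (Y, S); its monoid algebra is K[G] as soon as
   (Y, S), read as a monoid presentation, makes every generator invertible. *)
Section Deframization.
Variables (K : comNzRingType) (Y : choiceType) (S : word_rel Y).

Local Notation KG := (monoid_alg K (presented_monoid S)).

Definition gen_alg (y : Y) : KG := mon K (pm_class S [:: y]).

Lemma gen_alg_word (w : free_monoid Y) :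
  mon K (pm_class S w) = \prod_(y <- w) gen_alg y.
Proof.
elim: w => [|y w IH]; first by rewrite big_nil.
by rewrite big_cons -IH -monM -pm_classM.
Qed.

Lemma gen_alg_rel u v : S u v ->
  \prod_(y <- u) gen_alg y = \prod_(y <- v) gen_alg y.
Proof. by move=> Suv; rewrite -!gen_alg_word (pm_class_rel Suv). Qed.

Definition eval_letter (I : choiceType) (b : I -> KG) (l : Y + I) : KG :=
  match l with inl y => gen_alg y | inr i => b i end.

Definition eval_word (I : choiceType) (b : I -> KG)
    (w : free_monoid (Y + I)%type) : KG :=
  \prod_(l <- w) eval_letter b l.

(* A family of bridge elements b_i of K[G], together with relations
   among them and the generators of G.  A relation is written as a pair of
   words in which [inr i] stands for b_i. *)
Record bridge_system := BridgeSystem {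
  bridge_index : choiceType;
  bridge_elt : bridge_index -> KG;
  bridge_rel : word_rel (Y + bridge_index)%type;
  bridge_relP : forall u v,
    bridge_rel u v -> eval_word bridge_elt u = eval_word bridge_elt v
}.

Variable B : bridge_system.

(* The alphabet Y + B^*: [inr i] is now the new symbol b_i^*. *)
Definition starred : choiceType := (Y + bridge_index B)%type.

Inductive starred_rel : word_rel starred :=
| StarredGroup u v of S u v : starred_rel (map inl u) (map inl v)
| StarredBridge u v of bridge_rel u v : starred_rel u v.

Definition starred_alg : algType K := presented_alg K starred_rel.

(* J indexes the framing generators z_j. *)
Variables (J : Type) (z : J -> Y).

Definition framing_diff (x : starred_alg) : Prop :=
  exists j, x = pa_word K starred_rel [:: inl (z j)] - 1.

Lemma framing_proper : ~ ideal_span framing_diff 1.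
Proof.
apply: (@ideal_span_proper _ _ (@pa_augment K _ starred_rel)) => _ [j ->].
by rewrite rmorphB rmorph1 /= pa_augment_word subrr.
Qed.

Definition deframization : algType K :=
  quotient_alg (generated_ideal framing_proper).

End Deframization.

(* Indices are 0-based: [i : 'I_n.-1] is the index i + 1 of the generators
   s_1, ..., s_(n-1), and [lo_ord i], [hi_ord i] : 'I_n are the two points
   exchanged by that transposition. *)

Section Indices.
Variable n : nat.

Definition lo_ord (i : 'I_n.-1) : 'I_n := widen_ord (leq_pred n) i.

Lemma hi_ord_proof (i : 'I_n.-1) : (i.+1 < n)%N.
Proof. by rewrite -ltn_predRL ltn_ord. Qed.

Definition hi_ord (i : 'I_n.-1) : 'I_n := Ordinal (hi_ord_proof i).

Definition adj_swap (i : 'I_n.-1) : 'I_n -> 'I_n := tperm (lo_ord i) (hi_ord i).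

Definition dist (i j : nat) : nat := `|i%:Z - j%:Z|%N.

Lemma adj_swap_lo i : adj_swap i (lo_ord i) = hi_ord i.
Proof. exact: tpermL. Qed.

Lemma adj_swap_hi i : adj_swap i (hi_ord i) = lo_ord i.
Proof. exact: tpermR. Qed.

Lemma adj_swap_id (i : 'I_n.-1) (j : 'I_n) :
  i <> j :> nat -> i.+1 <> j :> nat -> adj_swap i j = j.
Proof.
by move=> ne1 ne2; apply: tpermD; apply/eqP => /(congr1 val).
Qed.

Lemma lo_hi (i j : 'I_n.-1) : j = i.+1 :> nat -> lo_ord j = hi_ord i.
Proof. by move=> E; apply: val_inj. Qed.

Variant adj_spec (i j : 'I_n.-1) : Prop :=
| Adj a b c of lo_ord i = a & hi_ord i = b & lo_ord j = b & hi_ord j = c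
    & adj_swap i c = c & adj_swap j a = a
| AdjRev a b c of lo_ord j = a & hi_ord j = b & lo_ord i = b & hi_ord i = c
    & adj_swap i a = a & adj_swap j c = c.

Lemma adjP (i j : 'I_n.-1) : dist i j = 1%N -> adj_spec i j.
Proof.
move=> ij; have [E|E] : (j = i.+1 :> nat \/ i = j.+1 :> nat)%N.
  by move: ij; rewrite /dist; lia.
- apply: Adj (erefl _) (erefl _) (lo_hi E) (erefl _) _ _.
    by apply: adj_swap_id => /=; lia.
  by apply: adj_swap_id => /=; lia.
- apply: AdjRev (erefl _) (erefl _) (lo_hi E) (erefl _) _ _.
    by apply: adj_swap_id => /=; lia.
  by apply: adj_swap_id => /=; lia.
Qed.

Inductive coxeter_rel (X : choiceType) (s : 'I_n.-1 -> X) : word_rel X :=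
| CoxSq i : coxeter_rel s [:: s i; s i] [::]
| CoxFar (i j : 'I_n.-1) of (1 < dist i j)%N :
    coxeter_rel s [:: s i; s j] [:: s j; s i]
| CoxBraid (i j : 'I_n.-1) of dist i j = 1%N :
    coxeter_rel s [:: s i; s j; s i] [:: s j; s i; s j].

(* The relations involving the letters [e i] that tS_n has in common with the
   bridge relations. *)
Inductive tie_rel (X : choiceType) (s e : 'I_n.-1 -> X) : word_rel X :=
| TieIdem i : tie_rel s e [:: e i; e i] [:: e i]
| TieComm i j : tie_rel s e [:: e i; e j] [:: e j; e i]
| TieSwap (i j : 'I_n.-1) of dist i j <> 1%N :
    tie_rel s e [:: s i; e j] [:: e j; s i]
| TieConj (i j : 'I_n.-1) of dist i j = 1%N :
    tie_rel s e [:: e i; s j; s i] [:: s j; s i; e j]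
| TieSlide1 (i j : 'I_n.-1) of dist i j = 1%N :
    tie_rel s e [:: e i; e j; s i] [:: e j; s i; e j]
| TieSlide2 (i j : 'I_n.-1) of dist i j = 1%N :
    tie_rel s e [:: e j; s i; e j] [:: s i; e i; e j].

End Indices.

Section AveragedProducts.
Variables (d n : nat) (K : numFieldType) (A : algType K).
Variables (S : 'I_n.-1 -> A) (Z : 'I_n -> A).
Hypothesis d_gt0 : (0 < d)%N.
Hypothesis ZC : forall a b, Z a * Z b = Z b * Z a.
Hypothesis Zd : forall a, Z a ^+ d = 1.
Hypothesis ZS : forall a i, Z a * S i = S i * Z (adj_swap i a).

Lemma SZ a i : S i * Z a = Z (adj_swap i a) * S i.
Proof. by rewrite ZS /adj_swap tpermK. Qed.

Definition EE a b : A := d%:R^-1 *: \sum_(k < d) Z a ^+ k * Z b ^+ (d - k).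

Lemma d_neq0 : d%:R != 0 :> K.
Proof. by rewrite pnatr_eq0 -lt0n. Qed.

Definition TT a b : A := d%:R^-1 *: \sum_(k < d) Z a ^+ (d.-1 - k) * Z b ^+ k.

Lemma TTC a b : TT a b = TT b a.
Proof.
rewrite /TT; congr (_ *: _); rewrite (reindex_inj rev_ord_inj) /=.
apply: eq_bigr => k _.
have -> : (d.-1 - (d - k.+1) = k)%N by have := ltn_ord k; lia.
have -> : (d - k.+1 = d.-1 - k)%N by lia.
by apply: commrX; apply: commr_sym; apply: commrX; apply: ZC.
Qed.

Lemma Z_EE a b c : Z a * EE b c = EE b c * Z a.
Proof.
rewrite /EE -scalerAr -scalerAl; congr (_ *: _).
apply: commr_sum => k _.
by apply: commrM; apply: commrX; apply: ZC.
Qed.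

Lemma EE_TT a b : EE a b = Z b * TT a b.
Proof.
rewrite /EE /TT -scalerAr mulr_sumr; congr (_ *: _).
rewrite (reindex_inj rev_ord_inj) /=; apply: eq_bigr => k _.
have -> : (d - (d - k.+1) = k.+1)%N by have := ltn_ord k; lia.
have -> : (d - k.+1 = d.-1 - k)%N by lia.
by rewrite exprS !mulrA (commrX _ (ZC b a)).
Qed.

Lemma Z_TT a b : Z a * TT a b = Z b * TT a b.
Proof.
apply/eqP; rewrite -subr_eq0 -mulrBl /TT -scalerAr.
by rewrite -subrXX_comm ?Zd ?subrr ?scaler0 //; apply: ZC.
Qed.

Lemma EEC a b : EE a b = EE b a.
Proof. by rewrite !EE_TT -Z_TT (TTC b a). Qed.

Lemma ZaEE a b : Z a * EE a b = Z b * EE a b.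
Proof. by rewrite EE_TT mulrA ZC -!mulrA Z_TT. Qed.

Lemma ZXEE a b k : Z a ^+ k * EE a b = Z b ^+ k * EE a b.
Proof.
by elim: k => // k IH; rewrite !exprSr -!mulrA ZaEE Z_EE !mulrA IH.
Qed.

Lemma EE_comm x a b : (forall c, Z c * x = x * Z c) -> EE a b * x = x * EE a b.
Proof.
move=> xC; rewrite /EE -scalerAr -scalerAl; congr (_ *: _).
apply/commr_sym/commr_sum => k _.
by apply: commrM; apply: commrX; apply/commr_sym/xC.
Qed.

Lemma EE_EE a b a' b' : EE a b * EE a' b' = EE a' b' * EE a b.
Proof. by apply: EE_comm => c; apply: Z_EE. Qed.

(* On the range of EE a b, the letters z_a and z_b may be exchanged. *)
Lemma EE_swap a b c : EE a c * EE a b = EE b c * EE a b.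
Proof.
rewrite [EE a c]/EE [EE b c]/EE -!scalerAl !mulr_suml; congr (_ *: _).
apply: eq_bigr => k _.
have C : Z a ^+ k * Z c ^+ (d - k) = Z c ^+ (d - k) * Z a ^+ k.
  by apply: commrX; apply/commr_sym/commrX/ZC.
have C' : Z b ^+ k * Z c ^+ (d - k) = Z c ^+ (d - k) * Z b ^+ k.
  by apply: commrX; apply/commr_sym/commrX/ZC.
by rewrite C C' -!mulrA ZXEE.
Qed.

Lemma EE_idem a b : EE a b * EE a b = EE a b.
Proof.
rewrite {1}/EE -scalerAl mulr_suml (eq_bigr (fun=> EE a b)) => [|k _].
  by rewrite sumr_const card_ord -scaler_nat scalerA mulVf ?scale1r ?d_neq0.
rewrite -mulrA -ZXEE mulrA -exprD subnKC ?Zd ?mul1r //.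
exact/ltnW/ltn_ord.
Qed.

Lemma S_EE i a b : S i * EE a b = EE (adj_swap i a) (adj_swap i b) * S i.
Proof.
have SX c m : S i * Z c ^+ m = Z (adj_swap i c) ^+ m * S i.
  elim: m => [|m IH]; first by rewrite mulr1 mul1r.
  by rewrite exprSr mulrA IH -mulrA SZ mulrA -exprSr.
rewrite /EE -scalerAr -scalerAl mulr_sumr mulr_suml; congr (_ *: _).
by apply: eq_bigr => k _; rewrite mulrA SX -!mulrA SX.
Qed.

Lemma EE_S i a b : EE a b * S i = S i * EE (adj_swap i a) (adj_swap i b).
Proof. by rewrite S_EE /adj_swap !tpermK. Qed.

Lemma EE_tri1 a b c : EE a b * EE a c = EE a b * EE b c.
Proof. by rewrite EE_EE EE_swap EE_EE. Qed.

Lemma EE_tri2 a b c : EE a b * EE b c = EE a c * EE b c.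
Proof. by rewrite (EEC a b) (EEC a c) EE_swap. Qed.

Let e i := EE (lo_ord i) (hi_ord i).

Lemma e_swap (i j : 'I_n.-1) : dist i j <> 1%N -> S i * e j = e j * S i.
Proof.
rewrite /e => ij; rewrite S_EE; have [->|neij] := eqVneq i j.
  by rewrite adj_swap_lo adj_swap_hi EEC.
have {}neij : (i : nat) <> j by move=> /ord_inj; apply/eqP.
by rewrite !adj_swap_id //=; move: ij; rewrite /dist; lia.
Qed.

Lemma e_conj (i j : 'I_n.-1) : dist i j = 1%N ->
  e i * S j * S i = S j * S i * e j.
Proof.
rewrite /e => /adjP; have := adj_swap_lo i; have := adj_swap_hi i.
have := adj_swap_lo j; have := adj_swap_hi j => + + + + [] a b c;
  move=> + + + + E1 E2 E3 E4; rewrite {}E1 {}E2 {}E3 {}E4.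
  move=> jc jb ib ia ic ja.
  by rewrite EE_S ja jb -mulrA EE_S ia ic mulrA.
move=> jb ja ic ib ia jc.
by rewrite EE_S jb jc -mulrA EE_S ia ic mulrA.
Qed.

Lemma e_slide1 (i j : 'I_n.-1) : dist i j = 1%N ->
  e i * e j * S i = e j * S i * e j.
Proof.
rewrite /e => /adjP; have := adj_swap_lo i; have := adj_swap_hi i.
move=> + + [] a b c; move=> + + E1 E2 E3 E4; rewrite {}E1 {}E2 {}E3 {}E4.
  move=> ib ia ic ja; rewrite -mulrA !EE_S mulrA !EE_S ia ib ic.
  by rewrite -!mulrA (EEC b a) EE_tri1 EE_tri2.
move=> ic ib ia jc; rewrite -mulrA !EE_S mulrA !EE_S ia ib ic.
by rewrite -!mulrA (EE_EE c b) (EE_tri1 a c b).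
Qed.

Lemma e_slide2 (i j : 'I_n.-1) : dist i j = 1%N ->
  e j * S i * e j = S i * e i * e j.
Proof.
rewrite /e => /adjP; have := adj_swap_lo i; have := adj_swap_hi i.
move=> + + [] a b c; move=> + + E1 E2 E3 E4; rewrite {}E1 {}E2 {}E3 {}E4.
  by move=> ib ia ic ja; rewrite EE_S ib ic -!mulrA EE_tri2.
move=> ic ib ia jc; rewrite EE_S ib ia -!mulrA.
by rewrite EE_EE EE_tri1 EE_EE.
Qed.

Lemma tie_rel_eval (X : choiceType) (ev : X -> A) (s t : 'I_n.-1 -> X) u v :
  (forall i, ev (s i) = S i) -> (forall i, ev (t i) = e i) ->
  tie_rel s t u v -> \prod_(l <- u) ev l = \prod_(l <- v) ev l.
Proof.
move=> evs evt; case=> [i|i j|i j ij|i j ij|i j ij|i j ij];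
  rewrite !big_cons !big_nil !mulr1 ?evs ?evt ?mulrA.
- exact: EE_idem.
- exact: EE_EE.
- exact: e_swap.
- exact: e_conj.
- exact: e_slide1.
- exact: e_slide2.
Qed.

Lemma eval2 (X : choiceType) (ev : X -> A) x y :
  \prod_(l <- [:: x; y]) ev l = ev x * ev y.
Proof. by rewrite !big_cons big_nil mulr1. Qed.

End AveragedProducts.

Section FramedSymmetricGroup.
Variables (d n : nat).

Definition framed_gen : choiceType := ('I_n.-1 + 'I_n)%type.
Definition sgen (i : 'I_n.-1) : framed_gen := inl i.
Definition zgen (j : 'I_n) : framed_gen := inr j.

Inductive framed_rel : word_rel framed_gen :=
| FramedCox u v of coxeter_rel sgen u v : framed_rel u v
| FramedOrder i : framed_rel (nseq d (zgen i)) [::]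
| FramedComm i j : framed_rel [:: zgen i; zgen j] [:: zgen j; zgen i]
| FramedAct j i : framed_rel [:: zgen j; sgen i]
    [:: sgen i; zgen (adj_swap i j)].

(* For d > 0 every generator is invertible in this monoid, so the monoid
   presented by framed_rel is also the group with that presentation. *)
Definition framed_sym : monoidType := presented_monoid framed_rel.

Definition tied_sym : monoidType :=
  presented_monoid (X := ('I_n.-1 + 'I_n.-1)%type)
    (fun u v => coxeter_rel inl u v \/ tie_rel inl inr u v).

Variable K : numFieldType.

(* z_(i+1)^(-k) is written z_(i+1)^(d-k), as z_(i+1)^d = 1. *)
Definition bridge (i : 'I_n.-1) : monoid_alg K framed_sym :=
  d%:R^-1 *: \sum_(k < d) gen_alg K framed_rel (zgen (lo_ord i)) ^+ k *
                         gen_alg K framed_rel (zgen (hi_ord i)) ^+ (d - k).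

Definition star_alphabet : choiceType := (framed_gen + 'I_n.-1)%type.
Definition s_ (i : 'I_n.-1) : star_alphabet := inl (sgen i).
Definition z_ (j : 'I_n) : star_alphabet := inl (zgen j).
Definition e_ (i : 'I_n.-1) : star_alphabet := inr i.

Inductive framed_bridge_rel : word_rel star_alphabet :=
| BridgeTie u v of tie_rel s_ e_ u v : framed_bridge_rel u v
| BridgeZ1 i : framed_bridge_rel [:: z_ (lo_ord i); e_ i]
                                 [:: z_ (hi_ord i); e_ i]
| BridgeZ2 i : framed_bridge_rel [:: z_ (hi_ord i); e_ i]
                                 [:: e_ i; z_ (lo_ord i)]
| BridgeZ3 i : framed_bridge_rel [:: e_ i; z_ (lo_ord i)]
                                 [:: e_ i; z_ (hi_ord i)]
| BridgeZFar (j : 'I_n) (i : 'I_n.-1) of (1 < dist i j)%N :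
    framed_bridge_rel [:: z_ j; e_ i] [:: e_ i; z_ j].

Local Notation S i := (gen_alg K framed_rel (sgen i)).
Local Notation Z j := (gen_alg K framed_rel (zgen j)).

Lemma framed_ZC a b : Z a * Z b = Z b * Z a.
Proof.
have := gen_alg_rel K (FramedComm a b).
by rewrite !eval2.
Qed.

Lemma framed_Zd a : Z a ^+ d = 1.
Proof.
have := gen_alg_rel K (FramedOrder a).
by rewrite big_nil -[X in \prod_(_ <- X) _]/(nseq d _) big_nseq -Monoid.iteropE.
Qed.

Lemma framed_ZS a i : Z a * S i = S i * Z (adj_swap i a).
Proof.
have := gen_alg_rel K (FramedAct a i).
by rewrite !eval2.
Qed.

Hypothesis d_gt0 : (0 < d)%N.

Lemma framed_bridge_relP u v : framed_bridge_rel u v ->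
  eval_word bridge u = eval_word bridge v.
Proof.
have ZC := framed_ZC; have Zd := framed_Zd; have ZS := framed_ZS.
rewrite /eval_word; case=> [{}u {}v|i|i|i|j i _].
- exact: (tie_rel_eval d_gt0 ZC Zd ZS).
- rewrite !eval2; exact: (ZaEE d_gt0 ZC Zd).
- rewrite !eval2.
  exact: (etrans (esym (ZaEE d_gt0 ZC Zd _ _)) (Z_EE _ ZC _ _ _)).
- rewrite !eval2; exact: (etrans (esym (Z_EE _ ZC _ _ _))
    (etrans (ZaEE d_gt0 ZC Zd _ _) (Z_EE _ ZC _ _ _))).
- rewrite !eval2; exact: (Z_EE _ ZC).
Qed.

Definition framed_bridges : bridge_system K framed_rel :=
  BridgeSystem framed_bridge_relP.

End FramedSymmetricGroup.

(* Main.v *)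
(* Both algebras are determined by generators and relations.  Setting every
   z_j to 1 turns the framing and z-bridge relations into identities, and what
   remains of the starred relations is exactly the presentation of tS_n.
   Universal properties therefore give mutually inverse morphisms fixing the
   letters s_i and exchanging e_i^* with e_i. *)
Require Import Defs.
From HB Require Import structures.
From mathcomp Require Import all_boot all_order all_algebra.
From mathcomp Require Import reals complex.
From mathcomp Require Import finmap monalg.

Set Implicit Arguments.
Unset Strict Implicit.
Unset Printing Implicit Defensive.

Import GRing.Theory.
Local Open Scope ring_scope.

(** * Extending a monoid morphism linearly to the monoid algebra *)

Section MonoidAlgebraLift.
Variables (K : comNzRingType) (M : monoidType) (A : algType K) (phi : M -> A).
Hypotheses (phi1 : phi 1%g = 1) (phiM : forall x y, phi (x * y)%g = phi x * phi y).

Definition malg_lift (f : monoid_alg K M) : A :=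
  \sum_(x <- msupp f) f@_x *: phi x.

(** Points outside the support contribute zero, so sums attached to different elements can be
    compared over one common index set. *)
Lemma malg_liftw (d : {fset M}) f : fsubset (msupp f) d ->
  malg_lift f = \sum_(x <- d) f@_x *: phi x.
Proof.
move=> le; apply: big_fset_incl => // k _ /mcoeff_outdom ->.
by rewrite scale0r.
Qed.

Lemma malg_liftU x : malg_lift (mon K x) = phi x.
Proof. by rewrite (malg_liftw msuppU_le) big_seq_fset1 mcoeffUU scale1r. Qed.

Lemma malg_lift_is_linear : linear malg_lift.
Proof.
move=> a f g; pose d := fsetU (msupp f) (msupp g).
have le : fsubset (msupp (a *: f + g)) d.
  apply: fsubset_trans (msuppD_le _ _) _.
  by apply: fsetUSS (fsubset_refl _); apply: msuppZ_le.
rewrite (malg_liftw le) (@malg_liftw d f) ?fsubsetUl //.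
rewrite (@malg_liftw d g) ?fsubsetUr //.
rewrite scaler_sumr -big_split /=; apply: eq_bigr => x _.
by rewrite mcoeffD mcoeffZ scalerDl scalerA.
Qed.

HB.instance Definition _ :=
  GRing.isLinear.Build K (monoid_alg K M) A *:%R malg_lift malg_lift_is_linear.

Lemma malg_lift_is_monoid_morphism : GRing.monoid_morphism malg_lift.
Proof.
split=> [|f g]; first by rewrite -phi1 -malg_liftU.
(* Expanding both factors reduces multiplicativity to basis elements, where it is [phiM]. *)
rewrite [f in LHS]monoid_algE [g in LHS]monoid_algE mulr_suml raddf_sum.
rewrite [malg_lift f]/malg_lift mulr_suml; apply: eq_bigr => x _.
rewrite mulr_sumr raddf_sum [malg_lift g]/malg_lift mulr_sumr.
apply: eq_bigr => y _.
by rewrite -!scalerAl -!scalerAr -monM !scalerA [LHS]linearZ /= malg_liftU phiM.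
Qed.

HB.instance Definition _ := GRing.isMonoidMorphism.Build
  (monoid_alg K M) A malg_lift malg_lift_is_monoid_morphism.

Lemma monoid_alg_universal :
  exists F : {lrmorphism monoid_alg K M -> A}, forall x, F (mon K x) = phi x.
Proof. by exists malg_lift; apply: malg_liftU. Qed.

End MonoidAlgebraLift.

Lemma monoid_alg_ext (K : comNzRingType) (M : monoidType) (V : lmodType K)
    (F G : {linear monoid_alg K M -> V}) :
  (forall x, F (mon K x) = G (mon K x)) -> F =1 G.
Proof.
move=> FG f; rewrite [f]monoid_algE !raddf_sum; apply: eq_bigr => x _.
by rewrite [LHS]linearZ [RHS]linearZ /= FG.
Qed.

(** * Factoring a morphism through the quotient by a generated ideal *)

Section QuotientLift.
Variables (K : comNzRingType) (A B : algType K) (G : A -> Prop).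
Hypothesis proper : ~ ideal_span G 1.
Variable f : {lrmorphism A -> B}.
Hypothesis fG : forall g, G g -> f g = 0.
Local Notation Q := (quotient_alg (generated_ideal proper)).

Definition quot_map (x : Q) : B := f (quot_lift x).

(** The chosen representative of the class of [x] differs from [x] by an element of the ideal, and
    [f] kills the ideal because it kills its generators. *)
Lemma quot_map_proj x : quot_map (quot_proj (generated_ideal proper) x) = f x.
Proof.
apply/eqP; rewrite -subr_eq0 -rmorphB; apply/eqP.
exact/(ideal_span_morph fG)/ideal_spanbP/quot_lift_proj.
Qed.

Lemma quot_map_is_linear : linear quot_map.
Proof.
move=> a x y; rewrite -[x]quot_liftK -[y]quot_liftK -linearP !quot_map_proj.
exact: linearP.
Qed.

HB.instance Definition _ :=
  GRing.isLinear.Build K Q B *:%R quot_map quot_map_is_linear.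

Lemma quot_map_is_monoid_morphism : GRing.monoid_morphism quot_map.
Proof.
split=> [|x y]; first by rewrite [LHS]quot_map_proj rmorph1.
rewrite -[x]quot_liftK -[y]quot_liftK -rmorphM !quot_map_proj.
exact: rmorphM.
Qed.

HB.instance Definition _ := GRing.isMonoidMorphism.Build Q B
  quot_map quot_map_is_monoid_morphism.

Lemma quotient_universal :
  exists F : {lrmorphism Q -> B},
    forall x, F (quot_proj (generated_ideal proper) x) = f x.
Proof. by exists quot_map; apply: quot_map_proj. Qed.

End QuotientLift.

(** * Morphisms out of presented monoids and presented algebras *)

Section PresentedLift.
Variables (K : comNzRingType) (X : choiceType) (R : word_rel X).

Lemma monoid_cong_prod (A : nzRingType) (ev : X -> A) :
  (forall u v, R u v -> \prod_(l <- u) ev l = \prod_(l <- v) ev l) ->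
  forall u v, monoid_cong R u v -> \prod_(l <- u) ev l = \prod_(l <- v) ev l.
Proof.
move=> evR u v; elim=> {u v} [u v x y Rxy||x y _ -> //|x y z _ -> _ -> //] //.
by rewrite !big_cat /= (evR _ _ Rxy).
Qed.

Lemma presented_monoid_universal (A : algType K) (ev : X -> A) :
  (forall u v, R u v -> \prod_(l <- u) ev l = \prod_(l <- v) ev l) ->
  exists F : {lrmorphism monoid_alg K (presented_monoid R) -> A},
    forall x, F (gen_alg K R x) = ev x.
Proof.
move=> evR; pose phi (x : presented_monoid R) := \prod_(l <- repr x) ev l.
(* Congruent words have equal products, so any word of a class computes [phi], not only the chosen
   representative. *)
have phiE w : phi (pm_class R w) = \prod_(l <- w) ev l.
  by apply: (monoid_cong_prod evR); apply/pm_classP; apply: pm_reprK.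
have phi1 : phi 1%g = 1 by rewrite [LHS]phiE big_nil.
(* A product of classes is by definition the class of the concatenated representatives, so [phiE]
   applies to it directly. *)
have phiM x y : phi (x * y)%g = phi x * phi y.
  by rewrite [LHS]phiE big_cat.
have [F FE] := monoid_alg_universal phi1 phiM.
by exists F => x; rewrite FE phiE big_seq1.
Qed.

Lemma free_mon_word (w : free_monoid X) :
  mon K w = \prod_(l <- w) mon K ([:: l] : free_monoid X).
Proof.
elim: w => [|x w IH]; first by rewrite big_nil.
by rewrite big_cons -IH -monM.
Qed.

Lemma pa_word_prod (w : free_monoid X) :
  pa_word K R w = \prod_(l <- w) pa_word K R [:: l].
Proof. by rewrite /pa_word free_mon_word rmorph_prod. Qed.

Lemma pa_word_rel u v : R u v -> pa_word K R u = pa_word K R v.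
Proof.
move=> Ruv; apply/quot_projP/ideal_spanbP.
(* Padding with units gives the shape [a * g * b] required by [IdealSpanG]. *)
by rewrite -[_ - _]mul1r -[_ * _]mulr1; apply: IdealSpanG; exists u, v.
Qed.

Lemma presented_alg_universal (A : algType K) (ev : X -> A) :
  (forall u v, R u v -> \prod_(l <- u) ev l = \prod_(l <- v) ev l) ->
  exists F : {lrmorphism presented_alg K R -> A},
    forall x, F (pa_word K R [:: x]) = ev x.
Proof.
move=> evR; pose phi (w : free_monoid X) := \prod_(l <- w) ev l.
have phi1 : phi 1%g = 1 by rewrite /phi big_nil.
have phiM x y : phi (x * y)%g = phi x * phi y by rewrite /phi big_cat.
have [F FE] := monoid_alg_universal phi1 phiM.
have FR g : word_rel_diff R g -> F g = 0.
  by case=> u [v [Ruv ->]]; rewrite rmorphB /= !FE /phi (evR _ _ Ruv) subrr.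
have [H HE] := quotient_universal (@word_rel_proper K X R) FR.
by exists H => x; rewrite [LHS]HE FE /phi big_seq1.
Qed.

(** Words span the free algebra linearly, and the image of a word is the product of the images of
    its letters. *)
Lemma presented_alg_ext (A : algType K) (F G : {lrmorphism presented_alg K R -> A}) :
  (forall x, F (pa_word K R [:: x]) = G (pa_word K R [:: x])) -> F =1 G.
Proof.
move=> FG y; rewrite -[y]quot_liftK.
pose p := quot_proj (generated_ideal (@word_rel_proper K X R)).
apply: (@monoid_alg_ext _ _ _ (F \o p) (G \o p)) => w.
change (F (pa_word K R w) = G (pa_word K R w)).
rewrite pa_word_prod !rmorph_prod.
by apply: eq_bigr => l _; apply: FG.
Qed.

Lemma presented_monoid_ext (A : algType K)
    (F G : {lrmorphism monoid_alg K (presented_monoid R) -> A}) :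
  (forall x, F (gen_alg K R x) = G (gen_alg K R x)) -> F =1 G.
Proof.
move=> FG; apply: monoid_alg_ext => x.
rewrite -[x]pm_reprK gen_alg_word !rmorph_prod.
by apply: eq_bigr => l _; apply: FG.
Qed.

End PresentedLift.

(** * Moving relations from one alphabet to another *)

Section RelationTransfer.
Variables (n : nat) (A : nzRingType) (X X' : choiceType).
Variables (ev : X -> A) (ev' : X' -> A).
Variables (s e : 'I_n.-1 -> X) (s' e' : 'I_n.-1 -> X').
Hypotheses (evs : forall i, ev (s i) = ev' (s' i)).
Hypotheses (eve : forall i, ev (e i) = ev' (e' i)).

(** Only the letters [s i] occur in these relations, so the evaluation depends only on their values.
    The same relations can thus be read in the framed, starred and tied alphabets. *)
Lemma coxeter_rel_transfer :
  (forall u v, coxeter_rel s' u v -> \prod_(l <- u) ev' l = \prod_(l <- v) ev' l) ->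
  forall u v, coxeter_rel s u v -> \prod_(l <- u) ev l = \prod_(l <- v) ev l.
Proof.
move=> H u v; case=> [i|i j ij|i j ij].
- by have := H _ _ (CoxSq s' i); rewrite !big_cons !big_nil !evs.
- by have := H _ _ (CoxFar s' ij); rewrite !big_cons !big_nil !evs.
- by have := H _ _ (CoxBraid s' ij); rewrite !big_cons !big_nil !evs.
Qed.

Lemma tie_rel_transfer :
  (forall u v, tie_rel s' e' u v -> \prod_(l <- u) ev' l = \prod_(l <- v) ev' l) ->
  forall u v, tie_rel s e u v -> \prod_(l <- u) ev l = \prod_(l <- v) ev l.
Proof.
move=> H u v; case=> [i|i j|i j ij|i j ij|i j ij|i j ij].
- by have := H _ _ (TieIdem s' e' i); rewrite !big_cons !big_nil ?evs !eve.
- by have := H _ _ (TieComm s' e' i j); rewrite !big_cons !big_nil ?evs !eve.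
- by have := H _ _ (TieSwap s' e' ij); rewrite !big_cons !big_nil !evs !eve.
- by have := H _ _ (TieConj s' e' ij); rewrite !big_cons !big_nil !evs !eve.
- by have := H _ _ (TieSlide1 s' e' ij); rewrite !big_cons !big_nil !evs !eve.
- by have := H _ _ (TieSlide2 s' e' ij); rewrite !big_cons !big_nil !evs !eve.
Qed.

End RelationTransfer.

(** * Universal property of the deframization *)

Section DeframizationUniversal.
Variables (K : comNzRingType) (Y : choiceType) (S : word_rel Y).
Variables (B : bridge_system K S) (J : Type) (z : J -> Y).

Local Notation R := (@starred_rel K Y S B).
Local Notation D := (deframization B z).

Definition deframed : {lrmorphism starred_alg B -> D} :=
  quot_proj (generated_ideal (@framing_proper K Y S B J z)).

Definition deframed_letter (l : starred B) : D := deframed (pa_word K R [:: l]).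

Lemma deframed_word w : deframed (pa_word K R w) = \prod_(l <- w) deframed_letter l.
Proof. by rewrite pa_word_prod rmorph_prod. Qed.

Lemma deframed_letter_rel u v : R u v ->
  \prod_(l <- u) deframed_letter l = \prod_(l <- v) deframed_letter l.
Proof. by move=> r; rewrite -!deframed_word (pa_word_rel K r). Qed.

Lemma deframed_framing j : deframed_letter (inl (z j)) = 1.
Proof.
apply/quot_projP/ideal_spanbP.
by rewrite -[_ - _]mul1r -[_ * _]mulr1; apply: IdealSpanG; exists j.
Qed.

(** There are two successive quotients: compatibility with [R] gives a morphism on the starred
    algebra, and the value 1 on each [z j] makes it kill the framing ideal. *)
Lemma deframization_universal (A : algType K) (ev : starred B -> A) :
  (forall u v, R u v -> \prod_(l <- u) ev l = \prod_(l <- v) ev l) ->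
  (forall j, ev (inl (z j)) = 1) ->
  exists F : {lrmorphism D -> A}, forall l, F (deframed_letter l) = ev l.
Proof.
move=> evR evz; have [F FE] := presented_alg_universal evR.
have Fz g : framing_diff z g -> F g = 0.
  by case=> j ->; rewrite rmorphB rmorph1 /= FE evz subrr.
have [H HE] := quotient_universal (@framing_proper K Y S B J z) Fz.
by exists H => l; rewrite [LHS]HE FE.
Qed.

Lemma deframization_ext (A : algType K) (F G : {lrmorphism D -> A}) :
  (forall l, F (deframed_letter l) = G (deframed_letter l)) -> F =1 G.
Proof.
move=> FG x; rewrite -[x]quot_liftK.
exact: (@presented_alg_ext _ _ _ _ (F \o deframed) (G \o deframed)).
Qed.

End DeframizationUniversal.

(** * The two mutually inverse morphisms for the tied symmetric monoid *)

Section TiedSymmetricMonoid.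
Variables (n d : nat) (K : numFieldType) (d_gt0 : (0 < d)%N).

Local Notation B := (framed_bridges n K d_gt0).
Local Notation D := (deframization B (@zgen n)).
Local Notation tied_gen := ('I_n.-1 + 'I_n.-1)%type.
Local Notation tied_rel := (fun u v : free_monoid tied_gen =>
  coxeter_rel inl u v \/ tie_rel inl inr u v).
Local Notation T := (monoid_alg K (presented_monoid tied_rel)).
Local Notation t := (@gen_alg K tied_gen tied_rel).
Local Notation delta := (@deframed_letter _ _ _ B _ (@zgen n)).

Definition tied_value (l : star_alphabet n) : T :=
  match l with
  | inl (inl i) => t (inl i)
  | inl (inr _) => 1
  | inr i => t (inr i)
  end.

Lemma tied_value_rel u v : @starred_rel _ _ _ B u v ->
  \prod_(l <- u) tied_value l = \prod_(l <- v) tied_value l.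
Proof.
case=> {u v} u v.
  rewrite !big_map; case=> {u v} [u v|i|i j|j i].
  - apply: coxeter_rel_transfer => [i|{}u {}v r]; last first.
      exact: (@gen_alg_rel K _ tied_rel _ _ (or_introl r)).
    by [].
  - by rewrite big_nil big1_seq // => l /andP[_ /nseqP[->]].
  - by rewrite !big_cons.
  (* The change of index from [j] to [adj_swap i j] is invisible, as every framing letter has value
     1. *)
  - by rewrite !big_cons !big_nil /= !mulr1 mul1r.
case=> {u v} [u v|i|i|i|j i _].
  apply: tie_rel_transfer => [i|i|{}u {}v r]; last first.
  - exact: (@gen_alg_rel K _ tied_rel _ _ (or_intror r)).
  - by [].
  - by [].
(* The four remaining bridge relations only move or rename a framing letter, so both sides evaluate
   to [t (inr i)]. *)
all: by rewrite !big_cons !big_nil /= !mulr1 ?mul1r.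
Qed.

Definition deframed_value (l : tied_gen) : D :=
  match l with inl i => delta (s_ i) | inr i => delta (e_ i) end.

Lemma deframed_value_rel u v : tied_rel u v ->
  \prod_(l <- u) deframed_value l = \prod_(l <- v) deframed_value l.
Proof.
case.
  (* Group relations enter the starred alphabet as words [map inl u], hence the evaluation
     [delta \o inl] on framed words. *)
  apply: (@coxeter_rel_transfer _ _ _ _ _ (delta \o inl) _ (@sgen n)) => //.
  move=> {}u {}v r.
  have := @deframed_letter_rel _ _ _ B _ (@zgen n) _ _
    (@StarredGroup _ _ _ B _ _ (FramedCox d r)).
  by rewrite !big_map.
apply: (@tie_rel_transfer _ _ _ _ _ delta _ _ (@s_ n) (@e_ n)) => //.
move=> {}u {}v r; apply: deframed_letter_rel.
by apply: StarredBridge; apply: BridgeTie.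
Qed.

Lemma deframization_tied_sym : exists f : {lrmorphism D -> T}, bijective f.
Proof.
have [f fE] := deframization_universal (z := @zgen n) tied_value_rel (fun=> erefl).
have [g gE] := presented_monoid_universal deframed_value_rel.
exists f, g.
  apply: (@deframization_ext _ _ _ _ _ _ _ (g \o f) idfun) => l /=.
  rewrite fE; case: l => [[i|j]|i] /=; rewrite ?gE //.
  (* The letter [z_j] is the only one that [f] does not send to a generator: it goes to 1, which is
     already its value in [D]. *)
  by rewrite rmorph1 [RHS]deframed_framing.
apply: (@presented_monoid_ext _ _ _ _ (f \o g) idfun) => l /=.
by rewrite gE; case: l => i; rewrite /= fE.
Qed.

End TiedSymmetricMonoid.

Theorem proposition4p1 (R : realType) (n d : nat)
    (n_gt0 : (0 < n)%N) (d_gt0 : (0 < d)%N) :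
  exists f : {lrmorphism
      deframization (framed_bridges n R[i] d_gt0) (@zgen n) ->
      monoid_alg R[i] (tied_sym n)},
    bijective f.
Proof. exact: deframization_tied_sym. Qed.
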